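(* Let $G$ be a graph on $n$ vertices, and let $r \geq 1$ be a positive integer. Then $G$ contains a relatively $\frac{1}{r}$-full subgraph on $\lfloor \frac{n}{r} \rfloor$, $\lceil \frac{n}{r} \rceil$ or $\lceil \frac{n}{r} \rceil + 1$ vertices.
   Context: Graphs are finite and simple. For $q \in [0,1]$, a subgraph $H$ of a graph $G$ is relatively $q$-full if $d_H(v) \geq q\, d_G(v)$ for all $v \in V(H)$, where $d_H(v)$ and $d_G(v)$ denote the degrees of $v$ in $H$ and $G$. (The empty subgraph on $0$ vertices satisfies this vacuously.) *)

(* Defs.v *)
From mathcomp Require Import all_boot all_order all_algebra.

Set Implicit Arguments.
Unset Strict Implicit.
Unset Printing Implicit Defensive.

Import Order.TTheory GRing.Theory Num.Theory.
Local Open Scope ring_scope.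

Record sgraph (V : finType) := SGraph {
  edge : rel V;
  edge_sym : symmetric edge;
  edge_irrefl : irreflexive edge
}.

Definition degree (V : finType) (G : sgraph V) (v : V) : nat :=
  #|[set w | edge G v w]|.

(* Subgraphs are not required to be induced. A subgraph keeps the ambient type
   V: its vertices are [verts], and all its edges join two elements of [verts],
   so the elements of V outside [verts] are merely isolated points of
   [sub_graph], not vertices of the subgraph. *)
Record subgraph (V : finType) (G : sgraph V) := Subgraph {
  verts : {set V};
  sub_graph : sgraph V;
  sub_verts : forall x y, edge sub_graph x y -> (x \in verts) && (y \in verts);
  sub_edges : forall x y, edge sub_graph x y -> edge G x y
}.

Definition relatively_full (R : realFieldType) (q : R) (V : finType)
    (G : sgraph V) (H : subgraph G) : Prop :=
  forall v, v \in verts H ->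
    q * (degree G v)%:R <= (degree (sub_graph H) v)%:R.

(* Main.v *)
(* Fix m = floor((n-1)/r), so that ceil(n/r) = m+1.  Consider the colourings of
   the vertices with r colours together with a distinguished colour j such that
   the class of j has m+1 or m+2 vertices and every other class m or m+1.
   Choose such a pair with the largest number of monochromatic edges.
   Recolouring a vertex v of the distinguished class with colour k, and
   distinguishing k instead of j, gives another such pair; by maximality v has
   at least as many neighbours in class j as in class k.  Averaging over k, at
   least 1/r of the neighbours of v lie in its own class, so class j induces
   the required subgraph. *)
Require Import Defs.
From mathcomp Require Import all_boot all_order all_algebra.
From mathcomp Require Import zify.

Set Implicit Arguments.
Unset Strict Implicit.
Unset Printing Implicit Defensive.

Import Order.TTheory GRing.Theory Num.Theory.
Local Open Scope ring_scope.

Section InducedSubgraph.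
Variables (V : finType) (G : sgraph V) (S : {set V}).

Definition induced_edge : rel V :=
  fun x y => [&& edge G x y, x \in S & y \in S].

Lemma induced_edge_sym : symmetric induced_edge.
Proof. by move=> x y; rewrite /induced_edge edge_sym [(x \in S) && _]andbC. Qed.

Lemma induced_edge_irrefl : irreflexive induced_edge.
Proof. by move=> x; rewrite /induced_edge edge_irrefl. Qed.

Definition induced_sgraph : sgraph V :=
  SGraph induced_edge_sym induced_edge_irrefl.

Lemma induced_edge_verts x y :
  edge induced_sgraph x y -> (x \in S) && (y \in S).
Proof. by case/andP. Qed.

Lemma induced_edge_sub x y : edge induced_sgraph x y -> edge G x y.
Proof. by case/andP. Qed.

Definition induced_subgraph : subgraph G :=
  Subgraph induced_edge_verts induced_edge_sub.

End InducedSubgraph.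

Lemma relatively_full_induced (V : finType) (G : sgraph V) (S : {set V})
    (r : nat) :
    (forall v, v \in S ->
       (degree G v <= r * #|[set w in S | edge G v w]|)%N) ->
  relatively_full (1 / r%:R : rat) (induced_subgraph G S).
Proof.
move=> hS v /= vS; have := hS v vS.
have -> : [set w in S | edge G v w] = [set w | edge (induced_sgraph G S) v w].
  by apply/setP=> w; rewrite !inE /= /induced_edge vS andbC.
rewrite -/(degree (induced_sgraph G S) v); case: r {hS} => [|r] le_d.
  (* For [r = 0] the inverse is [0] by convention, so the bound is trivial. *)
  by rewrite invr0 mulr0 mul0r ler0n.
by rewrite mul1r ler_pdivrMl ?ltr0n// -natrM ler_nat.
Qed.

Section Recolouring.
Variables (V I : finType) (G : sgraph V).
Implicit Types (c : {ffun V -> I}) (v : V) (i k : I).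

Definition colour_class c i : {set V} := [set x | c x == i].

Definition colour_degree c i v : nat :=
  #|[set w in colour_class c i | edge G v w]|.

(* The number of ordered pairs, hence twice the number of monochromatic edges. *)
Definition mono_pairs c : nat :=
  \sum_x \sum_y (edge G x y && (c x == c y)).

Definition recolour c v k : {ffun V -> I} :=
  [ffun x => if x == v then k else c x].

Lemma degree_sum_colours c v : degree G v = (\sum_i colour_degree c i v)%N.
Proof.
rewrite /degree -sum1_card (partition_big c xpredT) //=; apply: eq_bigr => i _.
rewrite /colour_degree -sum1_card; apply: eq_bigl => w.
by rewrite !inE andbC.
Qed.

(** Since [v] is not its own neighbour, its colour does not enter these counts. *)
Lemma colour_degree_recolour c v k i :
  colour_degree (recolour c v k) i v = colour_degree c i v.
Proof.
apply: eq_card => w; rewrite !inE ffunE.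
by have [->|//] := eqVneq w v; rewrite edge_irrefl !andbF.
Qed.

(** Isolates the dependence on the colour of [v]: the row and the column of [v] contribute equally
    by symmetry, and the remaining double sum avoids [v]. *)
Lemma mono_pairsD1 c v :
  mono_pairs c = (2 * colour_degree c (c v) v +
    \sum_(x | x != v) \sum_(y | y != v) (edge G x y && (c x == c y)))%N.
Proof.
have degE : (\sum_(y | y != v) (edge G v y && (c v == c y)) =
             colour_degree c (c v) v)%N.
  rewrite /colour_degree -sum1dep_card big_mkcond [RHS]big_mkcond /=.
  apply: eq_bigr => y _; rewrite !inE.
  have [->|_] := eqVneq y v; first by rewrite edge_irrefl andbF.
  by rewrite [c v == _]eq_sym andbC; case: (_ && _).
rewrite /mono_pairs (bigD1 v) //= (bigD1 v) //= edge_irrefl add0n degE.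
rewrite mul2n -addnn -addnA; congr addn.
rewrite -degE -big_split /=; apply: eq_bigr => x _.
by rewrite (bigD1 v) //= edge_sym [c x == _]eq_sym.
Qed.

(** Pairs avoiding [v] count the same before and after. The additive form avoids truncated
    subtraction. *)
Lemma mono_pairs_recolour c v k :
  (mono_pairs (recolour c v k) + 2 * colour_degree c (c v) v =
   mono_pairs c + 2 * colour_degree c k v)%N.
Proof.
rewrite (mono_pairsD1 (recolour c v k) v) (mono_pairsD1 c v).
rewrite colour_degree_recolour ffunE eqxx.
under eq_bigr => x xv do
  under eq_bigr => y yv do rewrite !ffunE (negPf xv) (negPf yv).
lia.
Qed.

Lemma card_colour_class_recolour c v k i : c v != k ->
  (#|colour_class (recolour c v k) i| + (i == c v) =
   #|colour_class c i| + (i == k))%N.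
Proof.
move=> cvk; rewrite (cardsD1 v) [in RHS](cardsD1 v) !inE ffunE eqxx.
have -> : colour_class (recolour c v k) i :\ v = colour_class c i :\ v.
  by apply/setP=> x; rewrite !inE ffunE; case: eqP.
rewrite [k == i]eq_sym [c v == i]eq_sym; lia.
Qed.

End Recolouring.

Definition near_balanced (V I : finType) (m : nat)
    (p : {ffun V -> I} * I) : bool :=
  [forall i, (m + (i == p.2) <= #|colour_class p.1 i| <= m.+1 + (i == p.2))%N].

(** The class left by [v] drops to [m] or [m+1] vertices and class [k] rises to [m+1] or [m+2], so
    the extra vertex travels with the distinguished colour. *)
Lemma near_balanced_recolour (V I : finType) (m : nat) (c : {ffun V -> I})
    (v : V) (k : I) :
  c v != k -> near_balanced m (c, c v) -> near_balanced m (recolour c v k, k).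
Proof.
move=> cvk /forallP /= bal; apply/forallP => i /=.
have := bal i; have := card_colour_class_recolour i cvk; lia.
Qed.

Lemma max_near_balanced_full (V I : finType) (G : sgraph V) (m : nat)
    (c : {ffun V -> I}) (j : I) :
    near_balanced m (c, j) ->
    (forall p : {ffun V -> I} * I,
       near_balanced m p -> mono_pairs G p.1 <= mono_pairs G c)%N ->
  forall v, v \in colour_class c j ->
    (degree G v <= #|I| * #|[set w in colour_class c j | edge G v w]|)%N.
Proof.
move=> bal maxc v; rewrite inE => /eqP cv; rewrite (degree_sum_colours G c).
(* Averaging without division: each of the [#|I|] colours is compared with [j] separately. *)
rewrite -sum_nat_const; apply: leq_sum => k _.
have [<-|jk] := eqVneq j k; first by [].
have cvk : c v != k by rewrite cv.
have := maxc (_, _) (near_balanced_recolour (m := m) cvk _); rewrite cv /=.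
move=> /(_ bal); have := mono_pairs_recolour G c v k; rewrite cv.
by rewrite -/(colour_degree G c j v); lia.
Qed.

Lemma dvdnS_mod (n r : nat) : (0 < r)%N ->
  (r %| n.+1)%N = ((n %% r).+1 == r)%N.
Proof.
move=> r_gt0; rewrite /dvdn -addn1 -modnDml addn1.
have [->|ne_r] := eqVneq (n %% r).+1 r; first by rewrite modnn.
by rewrite modn_small // ltn_neqAle ne_r ltn_pmod.
Qed.

(** By induction: the new element [n] joins class [n %% r], and the quotient grows exactly when the
    remainder wraps around to [0]. *)
Lemma card_residue_class (n r i : nat) : (i < r)%N ->
  (\sum_(k < n) (k %% r == i) = n %/ r + (i < n %% r))%N.
Proof.
move=> ir; have r_gt0 := leq_ltn_trans (leq0n i) ir.
elim: n => [|n IHn]; first by rewrite big_ord0 div0n mod0n.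
rewrite big_ord_recr /= IHn divnS // modnS dvdnS_mod //.
by have := ltn_pmod n r_gt0; case: (_.+1 =P _); lia.
Qed.

Lemma near_balanced_exists (V : finType) (r : nat) : (0 < #|V|)%N ->
  exists p : {ffun V -> 'I_r.+1} * 'I_r.+1, near_balanced (#|V|.-1 %/ r.+1) p.
Proof.
(* Colouring cyclically along the enumeration of [V], class [0] receives the first vertex of every
   round, complete or not, hence exactly [m+1] vertices for [m = #|V|.-1 %/ r.+1]. *)
move=> V_gt0; exists ([ffun x => inord (enum_rank x %% r.+1)], ord0).
apply/forallP => i /=.
have -> : #|colour_class [ffun x : V => inord (enum_rank x %% r.+1) : 'I_r.+1] i|
    = (\sum_(k < #|V|) (k %% r.+1 == i))%N.
  rewrite -sum1dep_card big_mkcond /= (reindex_onto enum_val enum_rank) /=.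
    apply: eq_big => k; rewrite ?enum_valK ?eqxx // => _.
    by rewrite !ffunE enum_valK -val_eqE /= inordK ?ltn_pmod //; case: (_ == _).
  by move=> x _; rewrite enum_rankK.
rewrite card_residue_class // -[i == ord0]/(i == 0%N :> nat).
have := ltn_ord i; move: (nat_of_ord i) V_gt0 => k; case: #|V| => // n _ /=.
have := ltn_pmod n (ltn0Sn r).
by rewrite divnS // modnS dvdnS_mod //; case: (_.+1 =P _); lia.
Qed.

Lemma full_set_exists (V : finType) (G : sgraph V) (r : nat) :
    (0 < #|V|)%N -> (0 < r)%N ->
  exists S : {set V},
    (forall v, v \in S ->
       (degree G v <= r * #|[set w in S | edge G v w]|)%N) /\
    ((#|V|.-1 %/ r).+1 <= #|S| <= (#|V|.-1 %/ r).+2)%N.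
Proof.
case: r => // r V_gt0 _; have [p0 bal0] := near_balanced_exists r V_gt0.
case: (arg_maxnP (fun p : {ffun V -> 'I_r.+1} * 'I_r.+1 => mono_pairs G p.1) bal0).
move=> [c j] bal maxc; exists (colour_class c j); split.
  by have := max_near_balanced_full bal maxc; rewrite card_ord.
by have /forallP/(_ j) := bal; rewrite eqxx /= !addn1.
Qed.

(** With [m = n.-1 %/ r], Euclidean division of [n.-1] gives [m * r < n <= m.+1 * r]. *)
Lemma ceil_natr_div (n r : nat) : (0 < n)%N -> (0 < r)%N ->
  Num.ceil (n%:R / r%:R : rat) = (n.-1 %/ r).+1%:Z.
Proof.
case: n => // n _ r_gt0; apply: ceil_def; rewrite /= intS addrAC subrr add0r.
rewrite -intS -!pmulrn ltr_pdivlMr ?ler_pdivrMr ?ltr0n // -!natrM.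
by rewrite ltr_nat ler_nat ltnS leq_divM ltn_ceil.
Qed.

Theorem theorem8 (V : finType) (G : sgraph V) (n r : nat)
    (hn : #|V| = n) (hr : (1 <= r)%N) :
  exists H : subgraph G,
    relatively_full (1 / r%:R : rat) H /\
    [\/ #|verts H|%:Z = Num.floor (n%:R / r%:R : rat),
        #|verts H|%:Z = Num.ceil (n%:R / r%:R : rat) |
        #|verts H|%:Z = Num.ceil (n%:R / r%:R : rat) + 1].
Proof.
case: (posnP n) => [n0|n_gt0].
  (* The case [n = 0] is separate because [n.-1] truncates there; the empty subgraph has the size
     given by the floor. *)
  exists (induced_subgraph G set0); split.
    by apply: relatively_full_induced => v; rewrite inE.
  by apply: Or31; rewrite /= cards0 n0 mul0r floor0.
have V_gt0 : (0 < #|V|)%N by rewrite hn.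
have [S [fullS sizeS]] := full_set_exists G V_gt0 hr.
exists (induced_subgraph G S); split; first exact: relatively_full_induced.
rewrite /= ceil_natr_div //; move: sizeS; rewrite hn.
case/andP => ge_m le_m; have [eq_m|ne_m] := eqVneq #|S| (n.-1 %/ r).+1.
  by apply: Or32; rewrite eq_m.
by apply: Or33; lia.
Qed.
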